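(* Suppose $\psi$ is an analytic function on $\mathbb{D}$ and $\varphi$ is an analytic self-map of $\mathbb{D}$ inducing a bounded weighted composition operator $W_{\psi,\varphi}$ on the Bloch space $\mathcal{B}$. Then $$\|W_{\psi,\varphi}\| \geq \max\left\{\|\psi\|_{\mathcal{B}},\ \frac{1}{2}|\psi(0)|\log\frac{1+|\varphi(0)|}{1-|\varphi(0)|}\right\}.$$
   Context: $\mathbb{D}$ is the open unit disk in $\mathbb{C}$. For $f$ analytic on $\mathbb{D}$, put $\beta_f = \sup_{z\in\mathbb{D}} (1-|z|^2)|f'(z)|$. The Bloch space $\mathcal{B}$ is the complex Banach space of analytic functions $f$ on $\mathbb{D}$ with $\beta_f<\infty$, with norm $\|f\|_{\mathcal{B}} = |f(0)|+\beta_f$. The weighted composition operator is $W_{\psi,\varphi}(f) = \psi\,(f\circ\varphi)$; it is bounded on $\mathcal{B}$ if it is a bounded linear operator from $\mathcal{B}$ to $\mathcal{B}$, and $\|W_{\psi,\varphi}\|$ denotes its operator norm. *)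

(* Defs.v *)
From Stdlib Require Import Reals.
From Coquelicot Require Import Coquelicot.

Open Scope R_scope.

(* A function on the open unit disk is represented by a total function
   [C -> C]; nothing below depends on its values outside the disk. *)

Definition in_disk (z : C) : Prop := Cmod z < 1.

(* Complex differentiability at every point: [ex_derive] is taken here over
   the scalar field [C_AbsRing]. *)
Definition analytic_on_disk (f : C -> C) : Prop :=
  forall z : C, in_disk z -> ex_derive (K := C_AbsRing) (V := C_NormedModule) f z.

Definition self_map_of_disk (phi : C -> C) : Prop :=
  forall z : C, in_disk z -> in_disk (phi z).

Definition bloch_seminorm (f : C -> C) : Rbar :=
  Lub_Rbar (fun r : R =>
    exists z : C, in_disk z /\ r = (1 - Cmod z ^ 2) * Cmod (C_derive f z)).

Definition in_bloch (f : C -> C) : Prop :=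
  analytic_on_disk f /\ is_finite (bloch_seminorm f).

(* Meaningful only when [in_bloch f], because [real] sends infinities to 0. *)
Definition bloch_norm (f : C -> C) : R :=
  Cmod (f (RtoC 0)) + real (bloch_seminorm f).

(* Linearity is required up to equality on the disk. *)
Record bounded_linear_on_bloch (T : (C -> C) -> (C -> C)) : Prop := {
  bloch_stable : forall f, in_bloch f -> in_bloch (T f);
  bloch_additive : forall f g, in_bloch f -> in_bloch g ->
    forall z, in_disk z ->
      T (fun w => Cplus (f w) (g w)) z = Cplus (T f z) (T g z);
  bloch_homogeneous : forall (c : C) f, in_bloch f ->
    forall z, in_disk z -> T (fun w => Cmult c (f w)) z = Cmult c (T f z);
  bloch_bounded : exists M : R, forall f, in_bloch f ->
    bloch_norm (T f) <= M * bloch_norm f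
}.

(* Meaningful only when [bounded_linear_on_bloch T], because of [real]. *)
Definition bloch_op_norm (T : (C -> C) -> (C -> C)) : R :=
  real (Lub_Rbar (fun r : R =>
    exists f : C -> C,
      in_bloch f /\ bloch_norm f <= 1 /\ r = bloch_norm (T f))).

Definition weighted_comp (psi phi : C -> C) (f : C -> C) : C -> C :=
  fun z => Cmult (psi z) (f (phi z)).

(* Main.v *)
Require Import Defs.
From Stdlib Require Import Reals Lra FunctionalExtensionality.
From Coquelicot Require Import Coquelicot.

Open Scope R_scope.

(** The operator norm dominates the norm of the image of every function in the
    closed unit ball of the Bloch space ([bloch_norm_le_op_norm]), so each of
    the two lower bounds comes from one well-chosen function.

    The constant [1] has norm one and is sent to [psi], which gives the bound
    by the norm of [psi].

    For the logarithmic bound, put [a = phi 0] and choose [c] of modulus one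
    with [c * a = Cmod a]. The function [w |-> artanh (c * w)] vanishes at [0]
    and has derivative [c / (1 - (c w)^2)], whose modulus is at most
    [1 / (1 - |w|^2)]; hence it lies in the unit ball
    ([Catanh_rot_unit_ball]). Its value at [a] is the real number
    [artanh |a| = 1/2 ln ((1 + |a|) / (1 - |a|))], so the image of this
    function has at [0] the modulus [|psi 0| artanh |a|], which bounds its norm
    from below. Among the functions of the unit ball that vanish at [0], this one
    is extremal at [a]: integrating the bound on the derivative along the radius
    shows that no other exceeds [artanh |a|] there.

    The analytic work is to have a holomorphic [artanh] on the disk. It is
    obtained from the principal logarithm on the right half-plane, written with
    the real [ln] and [atan] and differentiated through the Cauchy-Riemann
    equations; [1 + w] and [1 - w] stay in that half-plane when [|w| < 1]. *)

(** * Complex derivatives from real partial derivatives *)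

(** The real differential of a pair [(u, v)] satisfying the Cauchy-Riemann
    equations is multiplication by the complex number [(a, b)]. The real and
    imaginary parts of the remainder are each [o(|w - z|)], hence so is the
    remainder. *)
Lemma is_derive_of_cauchy_riemann (u v : R -> R -> R) (z : C) (a b : R) :
  differentiable_pt_lim u (fst z) (snd z) a (- b) ->
  differentiable_pt_lim v (fst z) (snd z) b a ->
  is_derive (K := C_AbsRing) (V := C_NormedModule)
    (fun w : C => (u (fst w) (snd w), v (fst w) (snd w)) : C) z ((a, b) : C).
Proof.
  intros Hu Hv; split.
  - apply is_linear_scal_l.
  - intros z' Hz' eps.
    (* A neighbourhood filter has only one limit, so it is enough to estimate
       the remainder at [z] itself. *)
    apply (is_filter_lim_locally_unique (V := AbsRing_NormedModule C_AbsRing)) in Hz'.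
    subst z'.
    (* Half of [eps] for each of the real and imaginary parts. *)
    assert (He : 0 < eps / 2) by (destruct eps as [e He]; simpl; lra).
    destruct (Hu (mkposreal _ He)) as [d1 H1].
    destruct (Hv (mkposreal _ He)) as [d2 H2].
    exists (mkposreal _ (Rmin_stable_in_posreal d1 d2)).
    intros w Hw.
    change (Cmod (w - z)%C < Rmin d1 d2) in Hw.
    change (Cmod (((u (fst w) (snd w), v (fst w) (snd w)) : C)
                  - ((u (fst z) (snd z), v (fst z) (snd z)) : C)
                  - (w - z) * ((a, b) : C))%C <= eps * Cmod (w - z)%C).
    destruct w as [x y], z as [x0 y0]; simpl fst in *; simpl snd in *.
    pose proof (Rmax_Cmod ((x, y) - (x0, y0))%C) as Hm; simpl in Hm.
    fold (x - x0) in Hm; fold (y - y0) in Hm.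
    pose proof (Rmax_l (Rabs (x - x0)) (Rabs (y - y0))) as Hl.
    pose proof (Rmax_r (Rabs (x - x0)) (Rabs (y - y0))) as Hr.
    pose proof (Rmin_l d1 d2) as Ml; pose proof (Rmin_r d1 d2) as Mr.
    specialize (H1 x y ltac:(lra) ltac:(lra)).
    specialize (H2 x y ltac:(lra) ltac:(lra)).
    simpl in H1, H2.
    set (m := Rmax _ _) in *.
    set (P := u x y - u x0 y0 - (a * (x - x0) + - b * (y - y0))) in *.
    set (Q := v x y - v x0 y0 - (b * (x - x0) + a * (y - y0))) in *.
    replace (((u x y, v x y) : C) - (u x0 y0, v x0 y0)
             - ((x, y) - (x0, y0)) * (a, b))%C with (RtoC P + (0, Q))%C
      by (unfold P, Q; apply injective_projections; simpl; ring).
    eapply Rle_trans; [apply Cmod_triangle|].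
    rewrite Cmod_R.
    replace (Cmod (0, Q)) with (Rabs Q).
    + pose proof (cond_pos eps). nra.
    + unfold Cmod; simpl. rewrite <- sqrt_Rsqr_abs; f_equal; unfold Rsqr; ring.
Qed.

(** * The principal logarithm on the right half-plane *)

(** The formula [atan (Im / Re)] is the principal argument only where the real
    part is positive. *)
Definition Clog (w : C) : C :=
  (1 / 2 * ln (fst w ^ 2 + snd w ^ 2), atan (snd w / fst w)).

Lemma locally_fst_pos (x y : R) : 0 < x -> locally (x, y) (fun p : R * R => 0 < fst p).
Proof.
  intros Hx; exists (mkposreal _ Hx); intros [x' y'] [H _].
  simpl in *. unfold ball in H; simpl in H; unfold AbsRing_ball, abs, minus, plus, opp in H; simpl in H.
  apply Rabs_def2 in H; lra.
Qed.

Lemma continuous_over_sq_norm (f : R * R -> R) (x y : R) : 0 < x -> continuous f (x, y) ->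
  continuous (fun p : R * R => f p / (fst p ^ 2 + snd p ^ 2)) (x, y).
Proof.
  intros Hx Hf.
  assert (Hfst : continuous (fun p : R * R => fst p) (x, y)) by apply continuous_fst.
  assert (Hsnd : continuous (fun p : R * R => snd p) (x, y)) by apply continuous_snd.
  apply (continuous_mult f); [exact Hf|].
  apply continuous_comp.
  - simpl. apply (continuous_plus (V := R_NormedModule)).
    + apply (continuous_mult (fun p : R * R => fst p)); [exact Hfst|].
      apply (continuous_mult (fun p : R * R => fst p)); [exact Hfst|apply continuous_const].
    + apply (continuous_mult (fun p : R * R => snd p)); [exact Hsnd|].
      apply (continuous_mult (fun p : R * R => snd p)); [exact Hsnd|apply continuous_const].
  - apply (ex_derive_continuous (K := R_AbsRing) (V := R_NormedModule)).
    auto_derive. simpl. nra.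
Qed.

(** The first partial derivatives of [1/2 ln (x^2 + y^2)] and [atan (y / x)]
    are continuous and are the real and imaginary parts of [1 / w], up to the
    signs in the Cauchy-Riemann equations. *)
Lemma is_derive_Clog (w : C) : 0 < fst w ->
  is_derive (K := C_AbsRing) (V := C_NormedModule) Clog w (/ w)%C.
Proof.
  destruct w as [x y]; simpl; intros Hx.
  assert (Hn : 0 < x ^ 2 + y ^ 2) by nra.
  unfold Cinv; simpl fst; simpl snd.
  apply (is_derive_of_cauchy_riemann
           (fun x y => 1 / 2 * ln (x ^ 2 + y ^ 2)) (fun x y => atan (y / x)));
    simpl fst; simpl snd; apply filterdiff_differentiable_pt_lim.
  - replace (- (- y / (x ^ 2 + y ^ 2))) with (y / (x ^ 2 + y ^ 2)) by (field; lra).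
    apply (is_derive_filterdiff (fun x y => 1 / 2 * ln (x ^ 2 + y ^ 2)) x y
             (fun x y => x / (x ^ 2 + y ^ 2)) (y / (x ^ 2 + y ^ 2))).
    + generalize (locally_fst_pos x y Hx); apply filter_imp.
      intros [p q] Hp; simpl in *. auto_derive; [nra|field; nra].
    + auto_derive; [nra|field; nra].
    + apply (continuous_over_sq_norm fst); [exact Hx|apply continuous_fst].
  - apply (is_derive_filterdiff (fun x y => atan (y / x)) x y
             (fun x y => - y / (x ^ 2 + y ^ 2)) (x / (x ^ 2 + y ^ 2))).
    + generalize (locally_fst_pos x y Hx); apply filter_imp.
      intros [p q] Hp; simpl in *. auto_derive; [lra|unfold Rsqr; field; nra].
    + auto_derive; [lra|unfold Rsqr; field; nra].
    + apply (continuous_over_sq_norm (fun p => - snd p)); [exact Hx|].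
      apply (continuous_opp (V := R_NormedModule)), continuous_snd.
Qed.

(** * The inverse hyperbolic tangent on the disk *)

(** The derivative is taken for the uniform structure given by the absolute
    value of [C], not for the product structure of [R * R]: the former is the
    one that the chain rule asks of its inner function. *)
Lemma is_derive_affine (c d z : C) :
  is_derive (K := C_AbsRing) (V := AbsRing_NormedModule C_AbsRing)
    (fun w : C => (d + c * w)%C) z c.
Proof.
  evar_last.
  - apply (is_derive_plus (K := C_AbsRing) (V := AbsRing_NormedModule C_AbsRing)
      (fun _ => d) (fun w => (c * w)%C)).
    + apply is_derive_const.
    + apply (is_derive_mult (K := C_AbsRing) (fun _ => c) (fun w => w)).
      * apply is_derive_const.
      * apply is_derive_id.
      * exact Cmult_comm.
  - change ((0 + (0 * z + c * 1))%C = c). ring.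
Qed.

Lemma is_derive_Cscal (k : C) (f : C -> C) (z l : C) :
  is_derive (K := C_AbsRing) (V := C_NormedModule) f z l ->
  is_derive (K := C_AbsRing) (V := C_NormedModule)
    (fun w => (k * f w)%C) z (k * l)%C.
Proof.
  intros H.
  apply (filterdiff_ext_lin (K := C_AbsRing) (U := AbsRing_NormedModule C_AbsRing)
           (V := C_NormedModule) _ (fun y : C => scal k (scal (y : C_AbsRing) l))).
  - apply (filterdiff_scal_r_fct (K := C_AbsRing)
             (U := AbsRing_NormedModule C_AbsRing) (V := C_NormedModule) k f).
    + exact Cmult_comm.
    + exact H.
  - intros y. change ((k * (y * l) = y * (k * l))%C). ring.
Qed.

Definition Catanh (w : C) : C := ((1 / 2)%R * (Clog (1 + w) - Clog (1 - w)))%C.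

(** Both [1 + c z] and [1 - c z] have positive real part, so the chain rule
    applies to each logarithm, and
    [1/2 (c / (1 + c z) + c / (1 - c z)) = c / (1 - (c z)^2)]. *)
Lemma is_derive_Catanh_rot (c z : C) : Cmod (c * z) < 1 ->
  is_derive (K := C_AbsRing) (V := C_NormedModule)
    (fun w => Catanh (c * w)) z (c / (1 - (c * z) * (c * z)))%C.
Proof.
  intros Hz.
  pose proof (re_le_Cmod (c * z)) as Hre; unfold Re in Hre.
  assert (Hre' : Rabs (fst (c * z)%C) < 1) by lra. apply Rabs_def2 in Hre'.
  assert (H1 : 0 < fst (1 + c * z)%C) by (change (0 < 1 + fst (c * z)%C); lra).
  assert (H2 : 0 < fst (1 - c * z)%C) by (change (0 < 1 - fst (c * z)%C); lra).
  assert (Hd : forall s : C, fst s > 0 -> s <> 0%C).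
  { intros s Hs E. rewrite E in Hs. simpl in Hs. lra. }
  unfold Catanh.
  evar_last.
  - apply (is_derive_ext (K := C_AbsRing) (V := C_NormedModule)
      (fun w => scal ((1 / 2)%R : C)
                 (minus (Clog (1 + c * w)%C) (Clog (1 + (- c) * w)%C)))).
    { intros t. change (RtoC (1 / 2) * (Clog (1 + c * t) - Clog (1 + - c * t)) =
        RtoC (1 / 2) * (Clog (1 + c * t) - Clog (1 - c * t)))%C.
      replace (1 + - c * t)%C with (1 - c * t)%C by ring. reflexivity. }
    apply is_derive_Cscal.
    apply (is_derive_minus (K := C_AbsRing) (V := C_NormedModule)).
    + apply (is_derive_comp (K := C_AbsRing) (V := C_NormedModule) Clog).
      * apply is_derive_Clog; exact H1.
      * apply is_derive_affine.
    + apply (is_derive_comp (K := C_AbsRing) (V := C_NormedModule) Clog).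
      * apply is_derive_Clog.
        replace (1 + - c * z)%C with (1 - c * z)%C by ring. exact H2.
      * apply is_derive_affine.
  - change (RtoC (1 / 2) * (c * / (1 + c * z) - (- c) * / (1 + - c * z))
      = c / (1 - c * z * (c * z)))%C.
    replace (RtoC (1 / 2)) with (/ 2)%C
      by (rewrite <- RtoC_inv; f_equal; lra).
    apply Hd in H1; apply Hd in H2.
    field. repeat split.
    + intros E; apply (Cmult_neq_0 _ _ H1 H2). rewrite <- E; ring.
    + intros E; apply H2; rewrite <- E; ring.
    + exact H1.
Qed.

Lemma Catanh_real (r : R) : 0 <= r < 1 ->
  Catanh r = RtoC (1 / 2 * ln ((1 + r) / (1 - r))).
Proof.
  intros Hr.
  assert (Hl : forall s, 0 < s -> Clog (RtoC s) = RtoC (ln s)).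
  { intros s Hs. unfold Clog; simpl. apply injective_projections; simpl.
    - replace (s * (s * 1) + 0 * (0 * 1)) with (s * s) by ring.
      rewrite ln_mult by lra. lra.
    - rewrite Rdiv_0_l. apply atan_0. }
  unfold Catanh. rewrite <- RtoC_plus, <- RtoC_minus, !Hl by lra.
  rewrite <- RtoC_minus, <- RtoC_mult, ln_div by lra. reflexivity.
Qed.

(** * Norms on the Bloch space *)

(** Finiteness from above is the bound [B]; the value at [0] shows that the
    supremum is not taken over the empty set, so it is not [m_infty] either. *)
Lemma bloch_seminorm_le (f : C -> C) (B : R) :
  (forall z, in_disk z -> (1 - Cmod z ^ 2) * Cmod (C_derive f z) <= B) ->
  is_finite (bloch_seminorm f) /\ real (bloch_seminorm f) <= B.
Proof.
  intros HB. unfold bloch_seminorm.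
  destruct (Lub_Rbar_correct (fun r : R =>
    exists z : C, in_disk z /\ r = (1 - Cmod z ^ 2) * Cmod (C_derive f z)))
    as [Hub Hlub].
  specialize (Hlub (Finite B)).
  destruct (Lub_Rbar _) as [s| |]; simpl in *.
  - split; [reflexivity|].
    apply Hlub. intros r [z [Hz ->]]. apply HB, Hz.
  - exfalso. apply Hlub. intros r [z [Hz ->]]. apply HB, Hz.
  - exfalso. apply (Hub ((1 - Cmod 0 ^ 2) * Cmod (C_derive f 0))).
    exists (RtoC 0). split; [unfold in_disk; rewrite Cmod_0; lra|reflexivity].
Qed.

(** A finite supremum is at least the nonnegative term at [z = 0], and [real]
    sends an infinite one to [0]. *)
Lemma bloch_seminorm_ge_0 (f : C -> C) : 0 <= real (bloch_seminorm f).
Proof.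
  unfold bloch_seminorm.
  match goal with |- context [Lub_Rbar ?E] =>
    destruct (Lub_Rbar_correct E) as [Hub _]; destruct (Lub_Rbar E) as [s| |] end;
    simpl in *; try lra.
  eapply Rle_trans;
    [|apply (Hub ((1 - Cmod 0 ^ 2) * Cmod (C_derive f 0)));
      exists (RtoC 0); split; [unfold in_disk; rewrite Cmod_0; lra|reflexivity]].
  rewrite Cmod_0. pose proof (Cmod_ge_0 (C_derive f 0)). nra.
Qed.

Lemma bloch_norm_ge_0 (f : C -> C) : 0 <= bloch_norm f.
Proof.
  unfold bloch_norm.
  pose proof (Cmod_ge_0 (f 0)); pose proof (bloch_seminorm_ge_0 f); lra.
Qed.

(** Boundedness of [T] makes the supremum defining the operator norm finite, so
    that its real value is still an upper bound. *)
Lemma bloch_norm_le_op_norm (T : (C -> C) -> (C -> C)) (f : C -> C) :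
  bounded_linear_on_bloch T -> in_bloch f -> bloch_norm f <= 1 ->
  bloch_norm (T f) <= bloch_op_norm T.
Proof.
  intros [_ _ _ [M HM]] Hf Hf1. unfold bloch_op_norm.
  match goal with |- context [Lub_Rbar ?E] =>
    destruct (Lub_Rbar_correct E) as [Hub Hlub] end.
  specialize (Hub (bloch_norm (T f)) (ex_intro _ f (conj Hf (conj Hf1 eq_refl)))).
  specialize (Hlub (Finite (Rabs M))).
  destruct (Lub_Rbar _) as [s| |]; simpl in *; [exact Hub| |contradiction].
  exfalso. apply Hlub. intros r [g [Hg [Hg1 ->]]]. simpl.
  eapply Rle_trans; [apply HM, Hg|].
  pose proof (bloch_norm_ge_0 g); pose proof (Rle_abs M); pose proof (Rabs_pos M). nra.
Qed.

(** * The two test functions *)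

Lemma const_1_unit_ball :
  in_bloch (fun _ => RtoC 1) /\ bloch_norm (fun _ => RtoC 1) <= 1.
Proof.
  assert (Hd : forall z : C, is_derive (K := C_AbsRing) (V := C_NormedModule)
            (fun _ => RtoC 1) z (RtoC 0)).
  { intros z. apply (is_derive_const (K := C_AbsRing) (V := C_NormedModule)). }
  destruct (bloch_seminorm_le (fun _ => RtoC 1) 0) as [Hfin Hle].
  { intros z _. pose proof (is_C_derive_unique _ _ _ (Hd z)) as E.
    simpl in E. rewrite E, Cmod_0. lra. }
  split; [split; [|exact Hfin]|].
  - intros z _. eexists; apply Hd.
  - unfold bloch_norm. rewrite Cmod_1. lra.
Qed.

(** The reverse triangle inequality gives
    [|1 - (c z)^2| >= 1 - |c z|^2 = 1 - |z|^2], which is exactly what the weight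
    in the Bloch seminorm compensates. *)
Lemma Catanh_rot_unit_ball (c : C) : Cmod c = 1 ->
  in_bloch (fun w => Catanh (c * w)) /\ bloch_norm (fun w => Catanh (c * w)) <= 1.
Proof.
  intros Hc.
  assert (Hm : forall z, Cmod (c * z) = Cmod z).
  { intros z. rewrite Cmod_mult, Hc. ring. }
  assert (Hd : forall z, in_disk z ->
    is_derive (K := C_AbsRing) (V := C_NormedModule)
      (fun w => Catanh (c * w)) z (c / (1 - (c * z) * (c * z)))%C).
  { intros z Hz. apply is_derive_Catanh_rot. rewrite Hm. exact Hz. }
  destruct (bloch_seminorm_le (fun w => Catanh (c * w)) 1) as [Hfin Hle].
  { intros z Hz. pose proof (is_C_derive_unique _ _ _ (Hd z Hz)) as E.
    simpl in E. rewrite E.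
    unfold in_disk in Hz. pose proof (Cmod_ge_0 z) as H0.
    set (s := (c * z * (c * z))%C).
    assert (Hs : Cmod s = Cmod z ^ 2).
    { unfold s. rewrite Cmod_mult, Hm. ring. }
    assert (Ht : 1 <= Cmod (1 - s) + Cmod s).
    { pose proof (Cmod_triangle (1 - s) s) as Ht.
      replace ((1 - s) + s)%C with (RtoC 1) in Ht by ring.
      rewrite Cmod_1 in Ht. exact Ht. }
    assert (Hpos : 0 < Cmod (1 - s)) by (rewrite Hs in Ht; nra).
    rewrite Cmod_div by (apply Cmod_gt_0; exact Hpos).
    rewrite Hc.
    apply (Rmult_le_reg_r (Cmod (1 - s))); [exact Hpos|].
    field_simplify; lra. }
  split; [split; [|exact Hfin]|].
  - intros z Hz. eexists; apply Hd, Hz.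
  - unfold bloch_norm. rewrite Cmult_0_r, Catanh_real by lra.
    replace ((1 + 0) / (1 - 0)) with 1 by field.
    rewrite ln_1, Rmult_0_r, Cmod_0. lra.
Qed.

Lemma rotation_to_modulus (a : C) : exists c : C, Cmod c = 1 /\ (c * a)%C = RtoC (Cmod a).
Proof.
  destruct (Ceq_dec a 0) as [->|Ha].
  - exists (RtoC 1). rewrite Cmod_1, Cmod_0. split; [reflexivity|ring].
  - exists (RtoC (Cmod a) / a)%C. split.
    + pose proof (proj1 (Cmod_gt_0 a) Ha).
      rewrite Cmod_div by exact Ha. rewrite Cmod_R, Rabs_pos_eq by lra. field; lra.
    + field; exact Ha.
Qed.

Theorem theorem2p3 (psi phi : C -> C)
  (hpsi : analytic_on_disk psi)
  (hphi : analytic_on_disk phi)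
  (hself : self_map_of_disk phi)
  (hW : bounded_linear_on_bloch (weighted_comp psi phi)) :
  bloch_op_norm (weighted_comp psi phi) >=
    Rmax (bloch_norm psi)
         (1 / 2 * Cmod (psi (RtoC 0)) *
          ln ((1 + Cmod (phi (RtoC 0))) / (1 - Cmod (phi (RtoC 0))))).
Proof.
  apply Rle_ge, Rmax_lub.
  - destruct const_1_unit_ball as [Hin Hnorm].
    replace psi with (weighted_comp psi phi (fun _ => RtoC 1)) at 1.
    + apply bloch_norm_le_op_norm; assumption.
    + apply functional_extensionality; intros z. apply Cmult_1_r.
  - destruct (rotation_to_modulus (phi (RtoC 0))) as [c [Hc Hca]].
    destruct (Catanh_rot_unit_ball c Hc) as [Hin Hnorm].
    eapply Rle_trans; [|exact (bloch_norm_le_op_norm _ _ hW Hin Hnorm)].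
    assert (Hr : 0 <= Cmod (phi 0) < 1).
    { split; [apply Cmod_ge_0|]. apply hself. unfold in_disk. rewrite Cmod_0. lra. }
    (* Of the norm of the image only the modulus of the value at [0] is kept. *)
    unfold bloch_norm, weighted_comp at 1.
    rewrite Hca, (Catanh_real _ Hr), Cmod_mult, Cmod_R.
    match goal with |- context [real (bloch_seminorm ?g)] =>
      pose proof (bloch_seminorm_ge_0 g) end.
    pose proof (Rle_abs (1 / 2 * ln ((1 + Cmod (phi 0)) / (1 - Cmod (phi 0))))).
    pose proof (Cmod_ge_0 (psi 0)). nra.
Qed.
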